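(* Let $(\mathcal{S},\mathcal{A},\boldsymbol{r},\mathcal{U},\boldsymbol{p}_0)$ be a robust MDP with a definable compact sa-rectangular uncertainty set $\mathcal{U}$. Define $\boldsymbol{v}^0=\boldsymbol{0}\in\mathbb{R}^{\mathcal{S}}$ and, for $t\in\mathbb{N}$, $$v^{t+1}_s=\max_{a\in\mathcal{A}}\ \min_{\boldsymbol{p}_{sa}\in\mathcal{U}_{sa}}\boldsymbol{p}_{sa}^\top(\boldsymbol{r}_{sa}+\boldsymbol{v}^t),\qquad\forall\,s\in\mathcal{S}.$$ Then $\left(\frac1t\boldsymbol{v}^t\right)_{t\ge1}$ converges to $\boldsymbol{g}^\star\in\mathbb{R}^{\mathcal{S}}$.
   Context: A robust MDP (RMDP) is a tuple $(\mathcal{S},\mathcal{A},\boldsymbol{r},\mathcal{U},\boldsymbol{p}_0)$: $\mathcal{S}$ (states) and $\mathcal{A}$ (actions) are finite nonempty sets, $\boldsymbol{r}\in\mathbb{R}^{\mathcal{S}\times\mathcal{A}\times\mathcal{S}}$ is the reward function (with $\boldsymbol{r}_{sa}=(r_{sas'})_{s'\in\mathcal{S}}$), the uncertainty set $\mathcal{U}\subset\Delta(\mathcal{S})^{\mathcal{S}\times\mathcal{A}}$ is a nonempty compact set of transition probabilities $\boldsymbol{P}=(\boldsymbol{p}_{sa})_{s,a}$, and $\boldsymbol{p}_0\in\Delta(\mathcal{S})$ is the initial distribution. The set $\mathcal{U}$ is sa-rectangular if $\mathcal{U}=\prod_{(s,a)}\mathcal{U}_{sa}$ with $\mathcal{U}_{sa}\subseteq\Delta(\mathcal{S})$.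 Definability (in the real exponential field): a subset of $\mathbb{R}^n$ is definable if it is the image, under a canonical projection $\mathbb{R}^{n+k}\to\mathbb{R}^n$ eliminating some set of $k$ variables, of a set of the form $\{\boldsymbol{x}\in\mathbb{R}^{n+k}: Q(x_1,\dots,x_{n+k},\exp(x_1),\dots,\exp(x_{n+k}))=0\}$ with $Q$ a real polynomial in $2(n+k)$ variables. $\mathcal{U}$ is viewed as a subset of $\mathbb{R}^{\mathcal{S}\times\mathcal{A}\times\mathcal{S}}$. The optimal gain $\boldsymbol{g}^\star\in\mathbb{R}^{\mathcal{S}}$ is $$g^\star_s=\max_{\pi\in\Pi_{\sf SD}}\ \inf_{\boldsymbol{P}\in\mathcal{U}}\ \lim_{T\to+\infty}\mathbb{E}_{\pi,\boldsymbol{P}}\Big[\tfrac{1}{T+1}\sum_{t=0}^{T}r_{s_ta_ts_{t+1}}\ \Big|\ s_0=s\Big],\quad s\in\mathcal{S},$$ where $\Pi_{\sf SD}$ is the set of stationary deterministic policies $\mathcal{S}\to\mathcal{A}$ and $\mathbb{E}_{\pi,\boldsymbol{P}}$ is expectation with respect to the law of $(s_t,a_t)_{t\ge0}$ induced by $\pi$ and $\boldsymbol{P}$. *)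

(* Defs.v *)
From HB Require Import structures.
From mathcomp Require Import all_boot all_order all_algebra.
From mathcomp Require Import all_classical all_reals all_analysis.
(* Not imported: its notations clash with those of MathComp-Analysis. *)
From mathcomp.multinomials Require mpoly.

Set Implicit Arguments.
Unset Strict Implicit.
Unset Printing Implicit Defensive.

Import Order.TTheory GRing.Theory Num.Theory.
Import numFieldNormedType.Exports.

Local Open Scope classical_set_scope.
Local Open Scope ring_scope.

(* MathComp-Analysis puts no canonical topology on function types: R^I, for I
   finite, is identified with the normed space of row vectors through the
   enumeration of I. *)
Definition vec (R : realType) (I : finType) (f : I -> R) : 'rV[R]_#|I| :=
  \row_j f (enum_val j).

(* The point (x_1, ..., x_m, exp x_1, ..., exp x_m). *)
Definition exp_point (R : realType) (m : nat) (x : 'rV[R]_m) (i : 'I_(m + m)) : R :=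
  match fintype.split i with
  | inl j => x ord0 j
  | inr j => expR (x ord0 j)
  end.

Definition exp_variety (R : realType) (m : nat) (Q : mpoly.mpoly (m + m)%N R) :
    set 'rV[R]_m :=
  [set x | mpoly.meval (exp_point x) Q = 0].

(* The canonical projections R^(n + k) -> R^n are the maps that keep, in order,
   the n coordinates listed by a strictly increasing f. *)
Definition definable (R : realType) (n : nat) (X : set 'rV[R]_n) : Prop :=
  exists (k : nat) (f : 'I_n -> 'I_(n + k)) (Q : mpoly.mpoly ((n + k) + (n + k))%N R),
    (forall i j : 'I_n, (i < j)%N -> (f i < f j)%N) /\
    X = [set \row_i x ord0 (f i) | x in exp_variety Q].

Definition simplex (R : realType) (S : finType) : set (S -> R) :=
  [set p | (forall s, 0 <= p s) /\ \sum_s p s = 1].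

Definition transition (R : realType) (S A : finType) (P : S * A * S -> R)
    (s : S) (a : A) : S -> R :=
  fun s' => P (s, a, s').

Record rmdp (R : realType) (S A : finType) := RMDP {
  rmdp_states : (0 < #|S|)%N;
  rmdp_actions : (0 < #|A|)%N;
  reward : S * A * S -> R;
  uncertainty : set (S * A * S -> R);
  initial : S -> R;
  uncertainty_prob : forall P, uncertainty P ->
    forall s a, simplex (transition P s a);
  uncertainty_neq0 : uncertainty !=set0;
  uncertainty_compact : compact [set vec P | P in uncertainty];
  initial_prob : simplex initial
}.

Definition sa_rectangular (R : realType) (S A : finType) (U : set (S * A * S -> R))
    (Usa : S -> A -> set (S -> R)) : Prop :=
  (forall s a, Usa s a `<=` @simplex R S) /\
  U = [set P | forall s a, Usa s a (transition P s a)].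

(* The maximum of a function on a nonempty finite type; see fmax_attained. *)
Definition fmax (R : realType) (I : finType) (f : I -> R) : R := sup (range f).

(* A history (s_0, a_0), ..., (s_T+1, a_T+1); its probability is the law of the
   state-action process started at s_0 = s on the corresponding cylinder. *)
Definition history_prob (R : realType) (S A : finType) (pi : {ffun S -> A})
    (P : S * A * S -> R) (s : S) (T : nat) (h : {ffun 'I_T.+2 -> S * A}) : R :=
  ((h ord0).1 == s)%:R *
  (\prod_(t < T.+2) ((h t).2 == pi (h t).1)%:R) *
  \prod_(t < T.+1) P (h (widen_ord (leqnSn T.+1) t), (h (lift ord0 t)).1).

Definition average_reward (R : realType) (S A : finType) (r : S * A * S -> R)
    (T : nat) (h : {ffun 'I_T.+2 -> S * A}) : R :=
  T.+1%:R^-1 *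
  \sum_(t < T.+1) r (h (widen_ord (leqnSn T.+1) t), (h (lift ord0 t)).1).

Definition expected_average (R : realType) (S A : finType) (r : S * A * S -> R)
    (pi : {ffun S -> A}) (P : S * A * S -> R) (s : S) (T : nat) : R :=
  \sum_(h : {ffun 'I_T.+2 -> S * A}) history_prob pi P s h * average_reward r h.

(* For stochastic P this Cesaro limit always exists. *)
Definition gain (R : realType) (S A : finType) (r : S * A * S -> R)
    (pi : {ffun S -> A}) (P : S * A * S -> R) (s : S) : R :=
  lim (expected_average r pi P s @ \oo).

Definition optimal_gain (R : realType) (S A : finType) (M : rmdp R S A) (s : S) : R :=
  fmax (fun pi : {ffun S -> A} =>
    inf [set gain (reward M) pi P s | P in uncertainty M]).

Definition backup (R : realType) (S A : finType) (r : S * A * S -> R) (v : S -> R)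
    (s : S) (a : A) (p : S -> R) : R :=
  \sum_s' p s' * (r (s, a, s') + v s').

(* The infimum is attained, hence a minimum; see backup_min_attained. *)
Definition bellman (R : realType) (S A : finType) (r : S * A * S -> R)
    (Usa : S -> A -> set (S -> R)) (v : S -> R) : S -> R :=
  fun s => fmax (fun a : A => inf [set backup r v s a p | p in Usa s a]).

Fixpoint value_iteration (R : realType) (S A : finType) (r : S * A * S -> R)
    (Usa : S -> A -> set (S -> R)) (t : nat) : S -> R :=
  match t with
  | 0%N => fun _ => 0
  | t'.+1 => bellman r Usa (value_iteration r Usa t')
  end.

Lemma fmax_attained (R : realType) (I : finType) (f : I -> R) :
  (0 < #|I|)%N -> exists2 i, fmax f = f i & forall j, f j <= f i.
Proof.
move=> /card_gt0P [i0 _].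
have [i _ fi] := @Order.TotalTheory.arg_maxP _ R I i0 xpredT f isT.
exists i => [|j]; last exact: fi.
apply/eqP; rewrite eq_le; apply/andP; split.
  by apply: ge_sup => [|_ [j _ <-]]; [exists (f i), i|exact: fi].
apply: ub_le_sup; last by exists i.
by exists (f i) => _ [j _ <-]; exact: fi.
Qed.

Lemma backup_min_attained (R : realType) (S A : finType) (M : rmdp R S A)
    (Usa : S -> A -> set (S -> R)) (r : S * A * S -> R) (v : S -> R) s a :
  sa_rectangular (uncertainty M) Usa ->
  exists2 p, Usa s a p & inf [set backup r v s a q | q in Usa s a] = backup r v s a p /\
    forall q, Usa s a q -> backup r v s a p <= backup r v s a q.
Proof.
move=> [_ UE].
pose F (x : 'rV[R]_#|{: S * A * S}|) : R :=
  \sum_s' x ord0 (enum_rank (s, a, s')) * (r (s, a, s') + v s').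
have FE P : F (vec P) = backup r v s a (transition P s a).
  by apply: eq_bigr => s' _; rewrite mxE enum_rankK.
have cF : continuous F.
  rewrite /F; elim: (index_enum S) => [|s' l IH].
    by under eq_fun do rewrite big_nil; exact: cst_continuous.
  under eq_fun do rewrite big_cons.
  move=> x.
  apply: (@continuousD _ R _ (fun y : 'rV[R]_#|{: S * A * S}| =>
    y ord0 (enum_rank (s, a, s')) * (r (s, a, s') + v s'))); last exact: IH.
  apply: (@continuousM _ _ (fun y : 'rV[R]_#|{: S * A * S}| =>
    y ord0 (enum_rank (s, a, s')))); first exact: coord_continuous.
  exact: cst_continuous.
have [P0 UP0] := uncertainty_neq0 M.
have [] := @compact_EVT_min _ R F [set vec P | P in uncertainty M].
- by exists (vec P0), P0.
- exact: uncertainty_compact.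
- exact: continuous_subspaceT.
move=> x; rewrite inE => -[P UP <-] minP.
have minq q : Usa s a q -> backup r v s a (transition P s a) <= backup r v s a q.
  move=> Uq; pose P' (u : S * A * S) := if u.1 == (s, a) then q u.2 else P u.
  have P'sa : transition P' s a = q by apply/funext => s'; rewrite /transition /P' eqxx.
  rewrite -P'sa -!FE; apply: minP; rewrite inE; exists P' => //.
  move: UP; rewrite UE => UP s1 a1.
  have [[-> ->]|ne] := eqVneq (s1, a1) (s, a); first by rewrite P'sa.
  suff -> : transition P' s1 a1 = transition P s1 a1 by exact: UP.
  by apply/funext => s'; rewrite /transition /P' /= (negPf ne).
have Usap : Usa s a (transition P s a) by move: UP; rewrite UE; apply.
exists (transition P s a) => //; split => //.
apply/eqP; rewrite eq_le; apply/andP; split.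
  apply: ge_inf; last by exists (transition P s a).
  by exists (backup r v s a (transition P s a)) => _ [q Uq <-]; exact: minq.
apply: lb_le_inf => [|_ [q Uq <-]]; last exact: minq.
by exists (backup r v s a (transition P s a)), (transition P s a).
Qed.

(* Main.v *)
(* Nature's discounted problem bounds the growth of value iteration from both
   sides. When nature chooses among finitely many kernels, discounted-optimal
   selectors are constant along a subsequence of vanishing discount rates l, and
   v_l itself is then a potential: with g = lim l v_l it certifies, up to e, that
   a fixed policy earns at least g and that a fixed kernel concedes at most g,
   i.e. g <= p g and g - e + h <= p (r + h), resp. the reverse inequalities.
   Let G be the infimum of the vectors g that a single kernel of U can certify as
   upper bounds. Applying the finite case to a well-chosen finite subfamily of U
   yields one policy that has, against each kernel of U separately, a lower
   certificate for G - e. Discounting nature's problem against that policy and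
   using compactness of U makes the potential h uniform over U. Both
   certificates then pass to gains and to value iteration, and G is the common
   limit. *)
Require Import Defs.
From mathcomp Require Import all_boot all_order all_algebra.
From mathcomp Require Import all_classical all_reals all_analysis.
From mathcomp Require Import ring lra.
Import Order.TTheory GRing.Theory Num.Theory.
Import numFieldNormedType.Exports.
Local Open Scope classical_set_scope.
Local Open Scope ring_scope.

(** * Expectations, and the iteration of topical maps *)

Definition mean {R : realType} {S : finType} (p v : S -> R) : R :=
  \sum_s p s * v s.

Section Mean.
Context {R : realType} {S : finType}.
Implicit Types (p v w : S -> R) (c : R).

Lemma meanD p v w : mean p (fun s => v s + w s) = mean p v + mean p w.
Proof. by rewrite -big_split; apply: eq_bigr => s _; rewrite mulrDr. Qed.

Lemma meanZ p c v : mean p (fun s => c * v s) = c * mean p v.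
Proof. by rewrite /mean mulr_sumr; apply: eq_bigr => s _; rewrite mulrCA. Qed.

Lemma mean_cst p c : simplex p -> mean p (fun=> c) = c.
Proof. by move=> [_ p1]; rewrite /mean -mulr_suml p1 mul1r. Qed.

Lemma mean_le p v w c : simplex p -> (forall s, v s <= w s + c) ->
  mean p v <= mean p w + c.
Proof.
move=> sp vw; rewrite -(mean_cst p c sp) -meanD.
by apply: ler_sum => s _; apply: ler_wpM2l; [exact: sp.1|exact: vw].
Qed.

Lemma finite_norm_bound v : exists2 c, 0 <= c & forall s, `|v s| <= c.
Proof.
exists (\sum_s `|v s|) => [|s]; first by apply: sumr_ge0 => s _; exact: normr_ge0.
by rewrite (bigD1 s) //= lerDl; apply: sumr_ge0 => t _; exact: normr_ge0.
Qed.

End Mean.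

(* Equivalently, F is monotone and commutes with the addition of constants. *)
Definition topical {R : realType} {S : finType} (F : (S -> R) -> S -> R) : Prop :=
  forall v w (c : R), (forall s, v s <= w s + c) -> forall s, F v s <= F w s + c.

Section Topical.
Context {R : realType} {S : finType} {F : (S -> R) -> S -> R}.
Hypothesis tF : topical F.

Lemma topical_nonexpansive v w (c : R) :
  (forall s, `|v s - w s| <= c) -> forall s, `|F v s - F w s| <= c.
Proof.
move=> vw s; rewrite ler_norml; apply/andP; split.
  suff : F w s <= F v s + c by lra.
  by apply: tF => t; have := vw t; rewrite ler_norml => /andP[]; lra.
suff : F v s <= F w s + c by lra.
by apply: tF => t; have := vw t; rewrite ler_norml => /andP[]; lra.
Qed.

(** The map sending [v] to [F ((1 - l) v)] is a [(1 - l)]-contraction whose iterates from 0 stay in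
    the ball of radius [C / l]. An iterate far enough along is an [e]-approximate fixed point, which
    is all that the later limits need. *)
Lemma discounted_value (C l e : R) : 0 < l < 1 -> 0 < e ->
  (forall s, `|F (fun=> 0) s| <= C) ->
  exists v, (forall s, `|l * v s| <= C) /\
    forall s, `|F (fun t => (1 - l) * v t) s - v s| <= e.
Proof.
move=> /andP[l0 l1] e0 FC.
pose G v := F (fun t : S => (1 - l) * v t).
have G_lip v w c : (forall s, `|v s - w s| <= c) ->
    forall s, `|G v s - G w s| <= (1 - l) * c.
  move=> vw; apply: topical_nonexpansive => s.
  by rewrite -mulrBr normrM gtr0_norm ?subr_gt0 // ler_pM2l ?subr_gt0.
have G0 s : `|G (fun=> 0) s| <= C.
  by rewrite /G; under [X in F X]eq_fun do rewrite mulr0.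
have scale_norm x : (`|l * x| <= C) = (`|x| <= C / l).
  by rewrite ler_pdivlMr // normrM (gtr0_norm l0) mulrC.
have bound n s : `|l * iter n G (fun=> 0) s| <= C.
  elim: n s => [|n IH] s; first by rewrite /= mulr0 normr0 (le_trans (normr_ge0 _) (FC s)).
  have : `|G (iter n G (fun=> 0)) s - G (fun=> 0) s| <= (1 - l) * (C / l).
    by apply: G_lip => t; rewrite subr0 -scale_norm.
  move=> /(le_trans (lerB_dist _ _)) H.
  have : `|G (iter n G (fun=> 0)) s| <= C / l.
    have -> : C / l = C + (1 - l) * (C / l) by field; rewrite gt_eqF.
    by have := G0 s; lra.
  by rewrite -scale_norm.
have step n s : `|iter n.+1 G (fun=> 0) s - iter n G (fun=> 0) s| <= (1 - l) ^+ n * C.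
  elim: n s => [|n IH] s; first by rewrite /= subr0 expr0 mul1r.
  by rewrite exprS -mulrA; apply: (G_lip (iter n.+1 G (fun=> 0))).
have cv : (1 - l) ^+ n * C @[n --> \oo] --> (0 : R).
  rewrite -(mul0r C); apply: cvgMl.
  by apply: cvg_expr; rewrite gtr0_norm ?subr_gt0 // gtrBl.
have [N _ HN] := cvgr0_norm_le _ cv _ e0.
exists (iter N G (fun=> 0)); split => // s.
apply: le_trans (step N s) _; apply: le_trans (ler_norm _) _.
by apply: HN => /=.
Qed.

(** The path [n g + h] is a subsolution, so by monotonicity the iterates stay above it up to a
    constant. The bound [c] on [h] is paid twice, at time 0 and at time [n]. *)
Lemma iter_topical_ge (g h : S -> R) :
  (forall (n : nat) s, n.+1%:R * g s + h s <= F (fun t => n%:R * g t + h t) s) ->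
  exists c : R, forall (n : nat) s, n%:R * g s - c <= iter n F (fun=> 0) s.
Proof.
move=> gF; have [c c0 hc] := finite_norm_bound h.
exists (c + c) => n s.
suff : n%:R * g s + h s <= iter n F (fun=> 0) s + c.
  by have := hc s; rewrite ler_norml => /andP[]; lra.
elim: n s => [|n IH] s.
  by rewrite mul0r !add0r (le_trans (ler_norm _) (hc s)).
exact: le_trans (gF n s) (tF _ _ _ IH s).
Qed.

Lemma iter_topical_le (g h : S -> R) :
  (forall (n : nat) s, F (fun t => n%:R * g t + h t) s <= n.+1%:R * g s + h s) ->
  exists c : R, forall (n : nat) s, iter n F (fun=> 0) s <= n%:R * g s + c.
Proof.
move=> gF; have [c c0 hc] := finite_norm_bound h.
exists (c + c) => n s.
suff : iter n F (fun=> 0) s <= n%:R * g s + h s + c.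
  by have := hc s; rewrite ler_norml => /andP[]; lra.
elim: n s => [|n IH] s.
  by rewrite mul0r !add0r /=; have := hc s; rewrite ler_norml => /andP[]; lra.
by rewrite iterS; apply: le_trans (tF _ _ _ IH s) _; rewrite lerD2r gF.
Qed.

End Topical.

(** * Limits along ultrafilters, in place of repeated extraction of subsequences *)

Section Ultrafilters.
Context {T : Type} {F : set_system T} {UF : UltraFilter F}.

(** The image of an ultrafilter decides every set, so each of its cluster points is a limit. *)
Lemma ultra_compact_cvg {X : topologicalType} (f : T -> X) (K : set X) :
  compact K -> (forall t, K (f t)) -> exists2 l, K l & f @ F --> l.
Proof.
move=> cK Kf; have [//|l [Kl cl]] := cK (f @ F) (fmap_proper_filter _ _).
  by apply: (@filterE _ F); exact: Kf.
exists l => // B lB.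
have [FB|FnB] := in_ultra_setVsetC (f @^-1` B) UF; first exact: FB.
by have [x []] : ~` B `&` B !=set0 by exact: cl.
Qed.

Lemma ultra_bounded_cvg {R : realType} (f : T -> R) (c : R) :
  (forall t, `|f t| <= c) -> exists l : R, f @ F --> l.
Proof.
move=> fc; have [t|l _ fl] := ultra_compact_cvg f _ (@segment_compact R (- c) c).
  by rewrite /= in_itv /= -ler_norml.
by exists l.
Qed.

Lemma ultra_finite {X : finType} (f : T -> X) : exists x, F [set t | f t = x].
Proof.
apply: contrapT => nF.
have : \forall t \near F, forall x, ~ f t = x.
  apply: filter_forall => x; have [Fx|//] := in_ultra_setVsetC [set t | f t = x] UF.
  by case: nF; exists x.
by move=> /filter_ex [t /(_ (f t))].
Qed.

End Ultrafilters.

Lemma cvg_mean {R : realType} {S : finType} {T : Type} {F : set_system T}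
    {FF : Filter F} {p v : T -> S -> R} {p0 v0 : S -> R} :
  (forall s, p t s @[t --> F] --> p0 s) -> (forall s, v t s @[t --> F] --> v0 s) ->
  mean (p t) (v t) @[t --> F] --> mean p0 v0.
Proof.
move=> pp vv; apply: (@cvg_big R S +%R 0 xpredT add_continuous T F _ (fun s t => p t s * v t s)) => s _.
by apply: cvgM; [exact: pp|exact: vv].
Qed.

(** * Bellman operators with attained minima *)

Section Bellman.
Context {R : realType} {S A : finType}.
Implicit Types (r : S * A * S -> R) (v : S -> R).

Lemma backup_mean r v s a p :
  backup r v s a p = mean p (fun s' => r (s, a, s') + v s').
Proof. by []. Qed.

Lemma backup_le r v w (c : R) s a p : simplex p -> (forall s, v s <= w s + c) ->
  backup r v s a p <= backup r w s a p + c.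
Proof. by move=> sp vw; apply: mean_le => // s'; rewrite -addrA lerD2l. Qed.

Lemma backupD r v w s a p : 
  backup r (fun s => w s + v s) s a p = mean p w + backup r v s a p.
Proof.
by rewrite !backup_mean -meanD; apply: eq_bigr => s' _; rewrite addrCA.
Qed.

(** Attainment is kept abstract so that finite families of kernels, the compact sets [Usa], and
    nature's problem against a fixed policy are treated alike. *)
Definition minimized r (V : S -> A -> set (S -> R)) : Prop :=
  forall v s a, exists2 p, V s a p &
    forall q, V s a q -> backup r v s a p <= backup r v s a q.

(** Optimal selectors trade the max and the inf for linear inequalities, the form in which the
    operator is estimated below. *)
Lemma bellman_optimizers r (V : S -> A -> set (S -> R)) v :
  (0 < #|A|)%N -> minimized r V ->
  exists (pi : S -> A) (p : S -> A -> S -> R),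
    [/\ forall s a, V s a (p s a),
        forall s q, V s (pi s) q -> bellman r V v s <= backup r v s (pi s) q &
        forall s a, backup r v s a (p s a) <= bellman r V v s].
Proof.
move=> A0 minV.
have /choice[p Hp] (s : S) : exists p : A -> S -> R, forall a, V s a (p a) /\
    forall q, V s a q -> backup r v s a (p a) <= backup r v s a q.
  suff /choice[p Hp] a : exists p : S -> R, V s a p /\
      forall q, V s a q -> backup r v s a p <= backup r v s a q by exists p.
  by have [p Vp Hp] := minV v s a; exists p.
have infE s a : inf [set backup r v s a q | q in V s a] = backup r v s a (p s a).
  have [Vp Hp'] := Hp s a; apply/eqP; rewrite eq_le; apply/andP; split.
    apply: ge_inf; last by exists (p s a).
    by exists (backup r v s a (p s a)) => _ [q Vq <-]; exact: Hp'.
  apply: lb_le_inf => [|_ [q Vq <-]]; last exact: Hp'.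
  by exists (backup r v s a (p s a)), (p s a).
have /choice[pi Hpi] (s : S) : exists a, bellman r V v s = backup r v s a (p s a) /\
    forall b, backup r v s b (p s b) <= backup r v s a (p s a).
  have [a aE Ha] := fmax_attained (fun a => inf [set backup r v s a q | q in V s a]) A0.
  exists a; rewrite -infE; split => // b; rewrite -infE; exact: Ha.
exists pi, p; split => [s a|s q Vq|s a]; first exact: (Hp s a).1.
  by rewrite (Hpi s).1; exact: (Hp _ _).2.
by rewrite (Hpi s).1; exact: (Hpi s).2.
Qed.

Lemma bellman_topical r (V : S -> A -> set (S -> R)) :
  (0 < #|A|)%N -> minimized r V -> (forall s a, V s a `<=` @simplex R S) ->
  topical (bellman r V).
Proof.
move=> A0 minV sV v w c vw s.
have [pi [_ [_ Hv _]]] := bellman_optimizers r V v A0 minV.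
have [_ [p [Vp _ Hw]]] := bellman_optimizers r V w A0 minV.
apply: le_trans (Hv _ _ (Vp s (pi s))) _.
apply: le_trans (backup_le _ _ _ _ _ _ _ (sV _ _ _ (Vp s (pi s))) vw) _.
by rewrite lerD2r.
Qed.

End Bellman.

(** * A sequence of vanishing discount rates *)

Section DiscountRate.
Context {R : realType}.

Definition discount_rate (k : nat) : R := k.+2%:R^-1.

Lemma discount_rate_itv k : 0 < discount_rate k < 1.
Proof. by rewrite invr_gt0 ltr0n /= invf_lt1 ?ltr0n // ltr1n. Qed.

Lemma discount_rate_cvg0 : discount_rate @ \oo --> 0.
Proof. by have := @cvg_harmonic R; rewrite -cvg_shiftS. Qed.

Lemma discount_rate_near (F : set_system nat) (e : R) : \oo `<=` F -> 0 < e ->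
  F [set k | discount_rate k <= e].
Proof.
move=> Foo e0; apply: Foo.
have := @cvgr_le _ _ _ _ _ _ discount_rate_cvg0 _ e0.
by apply.
Qed.

End DiscountRate.

(** * The game in which nature has finitely many kernels *)

Section FiniteGame.
Context {R : realType} {S A I : finType}.
Context {r : S * A * S -> R} {P : I -> S * A * S -> R}.
Hypothesis A0 : (0 < #|A|)%N.
Hypothesis I0 : (0 < #|I|)%N.
Hypothesis sP : forall i s a, simplex (transition (P i) s a).

Let V s a : set (S -> R) := range (fun i => transition (P i) s a).

Let minV : minimized r V.
Proof.
move=> v s a; have /card_gt0P[i0 _] := I0.
have [i _ iP] := @Order.TotalTheory.arg_minP _ R I i0 xpredT
  (fun i => backup r v s a (transition (P i) s a)) isT.
by exists (transition (P i) s a); [exists i|move=> _ [j _ <-]; exact: iP].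
Qed.

Let simplexV s a : V s a `<=` @simplex R S.
Proof. by move=> _ [i _ <-]; exact: sP. Qed.

(** The precision is [l] itself, so that it vanishes with the discount rate. Selectors are finite
    functions: they range over a finite type and can be frozen along an ultrafilter. *)
Lemma finite_game_discounted : exists C : R, forall l : R, 0 < l < 1 ->
  exists x : (S -> R) * ({ffun S -> A} * {ffun S * A -> I}),
  [/\ forall s, `|l * x.1 s| <= C,
      forall s i, x.1 s - l <= backup r (fun t => (1 - l) * x.1 t) s (x.2.1 s)
        (transition (P i) s (x.2.1 s)) &
      forall s a, backup r (fun t => (1 - l) * x.1 t) s a
        (transition (P (x.2.2 (s, a))) s a) <= x.1 s + l].
Proof.
have tB := bellman_topical r V A0 minV simplexV.
have [C _ BC] := finite_norm_bound (bellman r V (fun=> 0)).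
exists C => l l01; have /andP[l0 _] := l01.
have [v [vC vl]] := discounted_value tB C l l l01 l0 BC.
have [pi [p [Vp Hpi Hp]]] :=
  bellman_optimizers r V (fun t => (1 - l) * v t) A0 minV.
have /choice[sigma Hs] (sa : S * A) :
    exists i, transition (P i) sa.1 sa.2 = p sa.1 sa.2.
  by have [i _ iE] := Vp sa.1 sa.2; exists i.
exists (v, (finfun pi, finfun sigma)); split => [//|s i|s a] /=.
  rewrite ffunE; apply: le_trans (Hpi s _ _); last by exists i.
  by have := vl s; rewrite ler_norml => /andP[]; lra.
rewrite ffunE (Hs (s, a)); apply: le_trans (Hp s a) _.
by have := vl s; rewrite ler_norml => /andP[]; lra.
Qed.

(** Multiplied by [l], the discounted inequalities lose their rewards in the limit and become the
    conditions on [g]; unscaled, at one small [l], they are the certificates. *)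
Lemma finite_game : exists (g : S -> R) (pi : {ffun S -> A}) (sigma : {ffun S * A -> I}),
  [/\ forall s i, g s <= mean (transition (P i) s (pi s)) g,
      forall s a, mean (transition (P (sigma (s, a))) s a) g <= g s,
      forall e, 0 < e -> exists h, forall s i,
        g s - e + h s <= backup r h s (pi s) (transition (P i) s (pi s)) &
      forall e, 0 < e -> exists h, forall s a,
        backup r h s a (transition (P (sigma (s, a))) s a) <= g s + e + h s].
Proof.
have [C HC] := finite_game_discounted.
have /choice[x Hx] k := HC _ (discount_rate_itv k).
have [F [UF Foo]] := ultraFilterLemma (_ : ProperFilter \oo).
pose u k s := discount_rate k * (x k).1 s.
have /choice[g ug] s : exists l : R, u k s @[k --> F] --> l.
  by apply: (ultra_bounded_cvg _ C) => k; have [+ _ _] := Hx k; apply.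
have [[pi sigma] Fx] := ultra_finite (fun k => (x k).2).
have l0 : discount_rate k @[k --> F] --> (0 : R).
  by move=> B /discount_rate_cvg0; exact: Foo.
have meanE p k : mean p (u k) = discount_rate k * mean p (x k).1 by rewrite meanZ.
have backupE s a p k : backup r (fun t => (1 - discount_rate k) * (x k).1 t) s a p =
    mean p (fun s' => r (s, a, s')) + (1 - discount_rate k) * mean p (x k).1.
  by rewrite backup_mean meanD meanZ.
(* This is [l] times a discounted backup, [c] being the mean immediate reward. *)
have lim2 (p : S -> R) (c : R) :
    discount_rate k * c + (1 - discount_rate k) * mean p (u k) @[k --> F] --> mean p g.
  rewrite -[X in _ --> X]add0r -[X in _ --> _ + X]mul1r.
  apply: cvgD; first by rewrite -(mul0r c); apply: cvgMl.
  apply: cvgM; last by apply: cvg_mean => s; [exact: cvg_cst|exact: ug].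
  by rewrite -[X in _ --> X]subr0; apply: cvgB => //; exact: cvg_cst.
have near0 (e : R) : 0 < e -> F [set k | discount_rate k <= e] by exact: discount_rate_near.
have nearg (e : R) : 0 < e -> \forall k \near F, forall s, `|g s - u k s| <= e.
  by move=> e0; apply: filter_forall => s; exact: (cvgr_dist_le _ _ (ug s)).
exists g, pi, sigma; split.
- move=> s i; set p := transition _ _ _.
  have ul : u k s - discount_rate k * discount_rate k @[k --> F] --> g s.
    by rewrite -[X in _ --> X]subr0 -[X in _ --> _ - X](mul0r 0); apply: cvgB => //; apply: cvgM.
  apply: (ler_cvg_to ul (lim2 p (mean p (fun s' => r (s, pi s, s'))))).
  near=> k; have [_ + _] := Hx k; have -> : (x k).2 = (pi, sigma) by near: k.
  move=> /(_ s i); rewrite backupE -/p /u meanE /=.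
  have /andP[lk _] := @discount_rate_itv R k.
  by move=> H; rewrite -mulrBr mulrCA -mulrDr ler_pM2l.
- move=> s a; set p := transition _ _ _.
  have ul : u k s + discount_rate k * discount_rate k @[k --> F] --> g s.
    by rewrite -[X in _ --> X]addr0 -[X in _ --> _ + X](mul0r 0); apply: cvgD => //; apply: cvgM.
  apply: (ler_cvg_to (lim2 p (mean p (fun s' => r (s, a, s')))) ul).
  near=> k; have [_ _] := Hx k; have -> : (x k).2 = (pi, sigma) by near: k.
  move=> /(_ s a); rewrite backupE -/p /u meanE /=.
  have /andP[lk _] := @discount_rate_itv R k.
  by move=> H; rewrite -mulrDr mulrCA -mulrDr ler_pM2l.
- move=> e e0; have e2 : 0 < e / 2 by rewrite divr_gt0.
  have [k [[xk lk] gk]] := filter_ex (filterI (filterI Fx (near0 _ e2)) (nearg _ e2)).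
  (* With [h = (1 - l) v], [v - l] is [h + l v - l], where [l v] is within [e / 2] of [g] and [l] is
     at most [e / 2]. *)
  exists (fun t => (1 - discount_rate k) * (x k).1 t) => s i.
  have [_ + _] := Hx k; rewrite xk /= => /(_ s i); apply: le_trans.
  by have := gk s; rewrite /u ler_norml /= in lk * => /andP[]; lra.
- move=> e e0; have e2 : 0 < e / 2 by rewrite divr_gt0.
  have [k [[xk lk] gk]] := filter_ex (filterI (filterI Fx (near0 _ e2)) (nearg _ e2)).
  exists (fun t => (1 - discount_rate k) * (x k).1 t) => s a.
  have [_ _] := Hx k; rewrite xk /= => /(_ s a) H; apply: le_trans H _.
  by have := gk s; rewrite /u ler_norml /= in lk * => /andP[]; lra.
Unshelve. all: by end_near. Qed.

End FiniteGame.

(** * Expected rewards over histories as iterates of a one-policy operator *)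

Definition policy_op {R : realType} {S A : finType} (r : S * A * S -> R)
    (pi : S -> A) (P : S * A * S -> R) (v : S -> R) (s : S) : R :=
  backup r v s (pi s) (transition P s (pi s)).

Section Histories.
Context {R : realType} {S A : finType}.
Variables (r : S * A * S -> R) (pi : {ffun S -> A}) (P : S * A * S -> R).
Local Notation X := (S * A)%type.

(** [history_prob] is the case [n = T + 1]; allowing [n = 0] gives inductions a path without
    transitions to start from. *)
Definition path_prob n (s : S) (h : {ffun 'I_n.+1 -> X}) : R :=
  ((h ord0).1 == s)%:R *
  (\prod_(t < n.+1) ((h t).2 == pi (h t).1)%:R) *
  \prod_(t < n) P (h (widen_ord (leqnSn n) t), (h (lift ord0 t)).1).

Definition path_reward n (h : {ffun 'I_n.+1 -> X}) : R :=
  \sum_(t < n) r (h (widen_ord (leqnSn n) t), (h (lift ord0 t)).1).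

Definition path_cons n (x : X) (h : {ffun 'I_n -> X}) : {ffun 'I_n.+1 -> X} :=
  [ffun i => oapp h x (unlift ord0 i)].

Lemma path_cons0 n x (h : {ffun 'I_n -> X}) : path_cons n x h ord0 = x.
Proof. by rewrite ffunE unlift_none. Qed.

Lemma path_consS n x (h : {ffun 'I_n -> X}) i : path_cons n x h (lift ord0 i) = h i.
Proof. by rewrite ffunE liftK. Qed.

Lemma sum_path_cons n (f : {ffun 'I_n.+1 -> X} -> R) :
  \sum_h f h = \sum_x \sum_h f (path_cons n x h).
Proof.
rewrite pair_big /= (reindex (fun xh => path_cons n xh.1 xh.2)) //=.
exists (fun h => (h ord0, [ffun i => h (lift ord0 i)])) => [[x h] _|h _] /=.
  by rewrite path_cons0; congr pair; apply/ffunP => i; rewrite ffunE path_consS.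
apply/ffunP => i; have [j ->|->] := unliftP ord0 i; first by rewrite path_consS ffunE.
by rewrite path_cons0.
Qed.

Lemma widen_ord0 n : widen_ord (leqnSn n.+1) ord0 = ord0.
Proof. exact: ord_inj. Qed.

Lemma widen_ord_lift0 n (i : 'I_n) :
  widen_ord (leqnSn n.+1) (lift ord0 i) = lift ord0 (widen_ord (leqnSn n) i).
Proof. exact: ord_inj. Qed.

Lemma path_prob_cons n s x (h : {ffun 'I_n.+1 -> X}) :
  path_prob n.+1 s (path_cons n.+1 x h) =
  (x == (s, pi s))%:R * (P (x, (h ord0).1) * path_prob n (h ord0).1 h).
Proof.
rewrite /path_prob big_ord_recl [X in _ * X]big_ord_recl widen_ord0 !path_cons0 !path_consS.
under eq_bigr do rewrite path_consS.
under [X in _ * (_ * X)]eq_bigr do rewrite widen_ord_lift0 !path_consS.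
rewrite eqxx mul1r.
have -> : (x == (s, pi s))%:R = ((x.1 == s)%:R * (x.2 == pi x.1)%:R) :> R.
  by case: x => u b; rewrite xpair_eqE /=; case: eqVneq => [->|]; rewrite /= ?mul1r ?mul0r.
by rewrite -!mulrA; congr (_ * (_ * _)); rewrite mulrCA.
Qed.

Lemma path_prob_start n s (h : {ffun 'I_n.+1 -> X}) :
  (h ord0).1 != s -> path_prob n s h = 0.
Proof. by rewrite /path_prob => /negPf ->; rewrite !mul0r. Qed.

(** Markov property at the first step: summing over [s'] adds nothing, since [path_prob n s' h]
    vanishes unless [h] starts at [s']. *)
Lemma path_prob_step n s (f : {ffun 'I_n.+2 -> X} -> R) :
  \sum_h path_prob n.+1 s h * f h =
  \sum_s' P (s, pi s, s') * \sum_h path_prob n s' h * f (path_cons n.+1 (s, pi s) h).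
Proof.
rewrite sum_path_cons (bigD1 (s, pi s)) //= [X in _ + X]big1 ?addr0; last first.
  by move=> x /negPf nx; apply: big1 => h _; rewrite path_prob_cons nx !mul0r.
under [RHS]eq_bigr do rewrite mulr_sumr.
rewrite exchange_big; apply: eq_bigr => h _ /=.
rewrite path_prob_cons eqxx mul1r (bigD1 (h ord0).1) //= big1 ?addr0 ?mulrA //.
by move=> s' ns'; rewrite path_prob_start 1?eq_sym // mul0r mulr0.
Qed.

Hypothesis sP : forall s a, simplex (transition P s a).

Lemma sum_path_prob n s : \sum_h path_prob n s h = 1.
Proof.
elim: n s => [|n IH] s.
  rewrite (reindex (fun x : X => [ffun=> x])) /=; last first.
    exists (fun h : {ffun 'I_1 -> X} => h ord0) => [x _|h _]; first by rewrite ffunE.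
    by apply/ffunP => i; rewrite ffunE (ord1 i).
  rewrite (bigD1 (s, pi s)) //= big1 ?addr0 => [|[u b]].
    by rewrite /path_prob big_ord0 big_ord1 !ffunE !eqxx !mulr1.
  rewrite /path_prob xpair_eqE big_ord0 big_ord1 !ffunE /=.
  by case: eqVneq => [->|_] //=; rewrite ?mul0r // => /negPf ->; rewrite mulr0 mul0r.
under eq_bigr do rewrite -[path_prob _ _ _]mulr1.
rewrite path_prob_step; under eq_bigr => s' _.
  by under eq_bigr do rewrite mulr1; rewrite IH mulr1; over.
by have [_] := sP s (pi s).
Qed.

Lemma expected_path_reward n s :
  \sum_h path_prob n s h * path_reward n h = iter n (policy_op r pi P) (fun=> 0) s.
Proof.
elim: n s => [|n IH] s.
  by apply: big1 => h _; rewrite /path_reward big_ord0 mulr0.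
rewrite path_prob_step iterS {1}/policy_op; apply: eq_bigr => s' _.
(* The first reward is the same for all continuations, whose total mass 1 moves it inside the inner
   sum. *)
congr (_ * _); rewrite -IH -[r _]mul1r -(sum_path_prob n s') mulr_suml -big_split.
apply: eq_bigr => h _ /=; rewrite -mulrDr /path_reward big_ord_recl widen_ord0 path_cons0 path_consS.
have [->|/path_prob_start ->] := eqVneq (h ord0).1 s'; last by rewrite !mul0r.
by congr (_ * (_ + _)); apply: eq_bigr => t _; rewrite widen_ord_lift0 !path_consS.
Qed.

Lemma expected_averageE T s : expected_average r pi P s T =
  T.+1%:R^-1 * iter T.+1 (policy_op r pi P) (fun=> 0) s.
Proof.
rewrite -expected_path_reward mulr_sumr; apply: eq_bigr => h _.
by rewrite /average_reward mulrCA.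
Qed.

End Histories.

(** * Linear growth rates and averages *)

Lemma linear_growth_le {R : realType} (a b c : R) :
  (forall n : nat, n%:R * a <= n%:R * b + c) -> a <= b.
Proof.
move=> abc; rewrite leNgt; apply/negP => ba.
have := archi_boundP (normr_ge0 (c / (a - b))).
move=> /(le_lt_trans (ler_norm _)); rewrite ltr_pdivrMr ?subr_gt0 //.
by have := abc (Num.bound `|c / (a - b)|); lra.
Qed.

Lemma average_cvg {R : realType} (w : nat -> R) (g : R) :
  (forall e, 0 < e -> exists c, forall n, n%:R * (g - e) - c <= w n) ->
  (forall e, 0 < e -> exists c, forall n, w n <= n%:R * (g + e) + c) ->
  n%:R^-1 * w n @[n --> \oo] --> g.
Proof.
move=> lo up; apply/cvgrPdistC_le => e e0.
have e2 : 0 < e / 2 by rewrite divr_gt0.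
have [[c lc] [c' uc]] := (lo _ e2, up _ e2).
pose m := `|c| + `|c'|.
near=> n.
have n0 : 0 < n%:R :> R by rewrite ltr0n; near: n; exact: nbhs_infty_gt.
have mn : m <= n%:R * (e / 2).
  rewrite -ler_pdivrMr //; near: n; exact: nbhs_infty_ger.
have := lc n; have := uc n.
have := ler_norm c; have := ler_norm c'; have := normr_ge0 c; have := normr_ge0 c'.
rewrite /m in mn => H1 H2 H3 H4 H5 H6.
have wn : `|w n - n%:R * g| <= n%:R * e by rewrite ler_norml; apply/andP; split; lra.
have -> : n%:R^-1 * w n - g = n%:R^-1 * (w n - n%:R * g).
  by field; rewrite gt_eqF.
by rewrite normrM gtr0_norm ?invr_gt0 // ler_pdivrMl.
Unshelve. all: by end_near. Qed.

(** * The gain of one policy against one kernel *)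

Section PolicyGain.
Context {R : realType} {S A : finType}.
Context {r : S * A * S -> R} {P : S * A * S -> R}.
Hypothesis sP : forall s a, simplex (transition P s a).

Lemma policy_op_topical pi : topical (policy_op r pi P).
Proof. by move=> v w c vw s; apply: backup_le => //; exact: sP. Qed.

(** Both hypotheses together make [n g + h] a subsolution: the first controls the slope term [n g],
    the second the increment [g]. *)
Lemma policy_iter_ge (pi : S -> A) (g : S -> R) :
  (forall s, g s <= mean (transition P s (pi s)) g) ->
  (exists h, forall s, g s + h s <= backup r h s (pi s) (transition P s (pi s))) ->
  exists c : R, forall (n : nat) s,
    n%:R * g s - c <= iter n (policy_op r pi P) (fun=> 0) s.
Proof.
move=> gP [h hP]; apply: (iter_topical_ge (policy_op_topical pi) g h) => n s.
rewrite /policy_op backupD meanZ -natr1 mulrDl mul1r -addrA.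
by apply: lerD => //; rewrite ler_wpM2l.
Qed.

Lemma policy_iter_le (pi : S -> A) (g : S -> R) :
  (forall s, mean (transition P s (pi s)) g <= g s) ->
  (exists h, forall s, backup r h s (pi s) (transition P s (pi s)) <= g s + h s) ->
  exists c : R, forall (n : nat) s,
    iter n (policy_op r pi P) (fun=> 0) s <= n%:R * g s + c.
Proof.
move=> gP [h hP]; apply: (iter_topical_le (policy_op_topical pi) g h) => n s.
rewrite /policy_op backupD meanZ -natr1 mulrDl mul1r -addrA.
by apply: lerD => //; rewrite ler_wpM2l.
Qed.

(** [gain] is a [lim], informative only once the averages converge. Giving every action the effect
    of [pi] leaves a game with one kernel where selectors have no influence; both certificates of
    [finite_game] then bear on the same iterates with the same [g], which forces convergence. *)
Lemma gain_growth (pi : {ffun S -> A}) (e : R) : 0 < e ->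
  exists c : R, forall (n : nat) s,
    n%:R * (gain r pi P s - e) - c <= iter n (policy_op r pi P) (fun=> 0) s
      <= n%:R * (gain r pi P s + e) + c.
Proof.
have [s0 _|S0] := pickP S; last by exists 0 => n s; have := S0 s.
pose P' (i : unit) (x : S * A * S) := P (x.1.1, pi x.1.1, x.2).
pose r' (x : S * A * S) := r (x.1.1, pi x.1.1, x.2).
have A0 : (0 < #|A|)%N by apply/card_gt0P; exists (pi s0).
have [||g [pi' [sigma [g1 g2 g3 g4]]]] := @finite_game R S A unit r' P' A0.
- by rewrite card_unit.
- by move=> i s a; exact: (sP s (pi s)).
have lo d : 0 < d -> exists c, forall n s,
    n%:R * (g s - d) - c <= iter n (policy_op r pi P) (fun=> 0) s.
  move=> d0; apply: (policy_iter_ge pi (fun s => g s - d)) => [s|].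
    by rewrite meanD mean_cst // lerD2r; exact: (g1 s tt).
  by have [h Hh] := g3 d d0; exists h => s; exact: (Hh s tt).
have up d : 0 < d -> exists c, forall n s,
    iter n (policy_op r pi P) (fun=> 0) s <= n%:R * (g s + d) + c.
  move=> d0; apply: (policy_iter_le pi (fun s => g s + d)) => [s|].
    by rewrite meanD mean_cst // lerD2r; exact: (g2 s (pi s)).
  by have [h Hh] := g4 d d0; exists h => s; exact: (Hh s (pi s)).
suff gE s : gain r pi P s = g s.
  move=> e0; have [[c lc] [c' uc]] := (lo _ e0, up _ e0).
  exists (Num.max c c') => n s; rewrite gE; apply/andP; split.
    by apply: le_trans (lc n s); rewrite lerB // le_max lexx.
  by apply: le_trans (uc n s) _; rewrite lerD2l le_max lexx orbT.
apply: cvg_lim => //.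
have : n%:R^-1 * iter n (policy_op r pi P) (fun=> 0) s @[n --> \oo] --> g s.
  apply: average_cvg => d d0.
    by have [c Hc] := lo _ d0; exists c => n.
  by have [c Hc] := up _ d0; exists c => n.
rewrite -cvg_shiftS; under [X in _ -> X]eq_cvg do rewrite expected_averageE //.
by [].
Qed.

Lemma gain_ge (pi : {ffun S -> A}) (g : S -> R) :
  (forall s, g s <= mean (transition P s (pi s)) g) ->
  (exists h, forall s, g s + h s <= backup r h s (pi s) (transition P s (pi s))) ->
  forall s, g s <= gain r pi P s.
Proof.
move=> gP hP s; have [c Hc] := policy_iter_ge pi g gP hP.
apply/ler_addgt0Pr => e e0; have [c' Hc'] := gain_growth pi e e0.
apply: (linear_growth_le _ _ (c + c')) => n.
by have := Hc n s; have /andP[] := Hc' n s; lra.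
Qed.

Lemma gain_le (pi : {ffun S -> A}) (g : S -> R) :
  (forall s, mean (transition P s (pi s)) g <= g s) ->
  (exists h, forall s, backup r h s (pi s) (transition P s (pi s)) <= g s + h s) ->
  forall s, gain r pi P s <= g s.
Proof.
move=> gP hP s; have [c Hc] := policy_iter_le pi g gP hP.
apply/ler_addgt0Pr => e e0; have [c' Hc'] := gain_growth pi e e0.
apply: (linear_growth_le _ _ (c + c')) => n.
by have := Hc n s; have /andP[] := Hc' n s; lra.
Qed.

End PolicyGain.

(** * Caps on the gain and an optimal policy *)

Section RobustMDP.
Context {R : realType} {S A : finType} {M : rmdp R S A}.
Context {Usa : S -> A -> set (S -> R)}.
Hypothesis rect : sa_rectangular (uncertainty M) Usa.
Local Notation r := (reward M).
Local Notation U := (uncertainty M).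

Let A0 : (0 < #|A|)%N := rmdp_actions M.
Let sU P : U P -> forall s a, simplex (transition P s a).
Proof. exact: uncertainty_prob. Qed.

Lemma rectangularP P : U P <-> forall s a, Usa s a (transition P s a).
Proof. by rewrite rect.2. Qed.

Lemma rectangular_glue (p : S -> A -> S -> R) : (forall s a, Usa s a (p s a)) ->
  U (fun x => p x.1.1 x.1.2 x.2).
Proof. by move=> Up; apply/rectangularP => s a; exact: Up. Qed.

Lemma bellman_reward_topical : topical (bellman r Usa).
Proof.
apply: bellman_topical => // [v s a|]; last exact: rect.1.
by have [p Up [_ pmin]] := backup_min_attained r v s a rect; exists p.
Qed.

(* [g] is an eventual upper bound on the average reward of every policy when
   nature plays the fixed kernel [P]. *)
Definition capped_by (P : S * A * S -> R) (g : S -> R) : Prop :=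
  (forall s a, mean (transition P s a) g <= g s) /\
  exists h, forall s a, backup r h s a (transition P s a) <= g s + h s.

Definition caps : set (S -> R) := [set g | exists2 P, U P & capped_by P g].

(** The infimum is taken state by state, and different states may call for different kernels. It
    turns out to be the optimal gain, see [optimal_gainE]. *)
Definition least_cap (s : S) : R := inf [set g s | g in caps].

Lemma gain_le_cap pi P g s : U P -> capped_by P g -> gain r pi P s <= g s.
Proof.
move=> UP [gP [h hP]]; apply: gain_le => //; first exact: sU.
by exists h.
Qed.

(** Keeps the infima of gains and of caps clear of the default value of [inf] on sets unbounded
    below. *)
Lemma gain_lower_bound : exists c : R, forall pi P s, U P -> c <= gain r pi P s.
Proof.
have [c c0 rc] := finite_norm_bound r.
exists (- c) => pi P s UP.
apply: (gain_ge (sU _ UP) pi (fun=> - c)) => [t|]; first by rewrite mean_cst //; exact: sU.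
exists (fun=> 0) => t; rewrite addr0 backup_mean.
rewrite -[leLHS](mean_cst _ _ (sU _ UP t (pi t))) -[leRHS]addr0.
apply: mean_le; first exact: sU.
by move=> t'; have := rc (t, pi t, t'); rewrite ler_norml !addr0 => /andP[].
Qed.

(** Rectangularity glues nature's selector [sigma] into one kernel of [U], so [g + e] caps the full
    problem, while the guarantee of [pi] holds against the family only. *)
Lemma finite_family_cap (I : finType) (P : I -> S * A * S -> R) :
  (0 < #|I|)%N -> (forall i, U (P i)) ->
  exists (g : S -> R) (pi : {ffun S -> A}),
  [/\ forall e, 0 < e -> caps (fun s => g s + e),
      forall i s, g s <= mean (transition (P i) s (pi s)) g &
      forall e, 0 < e -> exists h, forall i s,
        g s - e + h s <= backup r h s (pi s) (transition (P i) s (pi s))].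
Proof.
move=> I0 UP.
have [g [pi [sigma [g1 g2 g3 g4]]]] := @finite_game R S A I r P A0 I0 (fun i => sU _ (UP i)).
exists g, pi; split => [e e0|//|e e0].
  exists (fun x => P (sigma x.1) x).
    by apply/rectangularP => s a; exact: ((rectangularP _).1 (UP (sigma (s, a))) s a).
  split=> [s a|]; last by have [h Hh] := g4 e e0; exists h => s a; exact: Hh.
  rewrite meanD mean_cst ?lerD2r; first exact: g2.
  exact: sU (UP (sigma (s, a))) s a.
by have [h Hh] := g3 e e0; exists h => i s; exact: Hh.
Qed.

Lemma caps_neq0 : caps !=set0.
Proof.
have [P UP] := uncertainty_neq0 M.
have unit0 : (0 < #|{: unit}|)%N by rewrite card_unit.
have [g [_ [capg _ _]]] := finite_family_cap unit (fun=> P) unit0 (fun=> UP).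
by exists (fun s => g s + 1); exact: capg.
Qed.

Lemma caps_lbound s : has_lbound [set g s | g in caps].
Proof.
have [c Hc] := gain_lower_bound; have /card_gt0P[a _] := A0.
exists c => _ [g [P UP Pg] <-].
exact: le_trans (Hc [ffun=> a] P s UP) (gain_le_cap _ _ _ _ UP Pg).
Qed.

Lemma least_cap_le g s : caps g -> least_cap s <= g s.
Proof. by move=> cg; apply: ge_inf; [exact: caps_lbound|exists g]. Qed.

Lemma least_cap_approx e s : 0 < e -> exists2 g, caps g & g s < least_cap s + e.
Proof.
move=> e0; have [|_ [g cg <-] ge] := @inf_adherent _ [set g s | g in caps] _ e0.
  by split; [have [g cg] := caps_neq0; exists (g s), g|exact: caps_lbound].
by exists g.
Qed.

(* One finite family containing near-optimal kernels for all states and, for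
   every policy, a counterexample to its near-optimality would give a policy
   that is near-optimal against its own counterexample. *)
Lemma near_optimal_policy e : 0 < e -> exists pi : {ffun S -> A}, forall P, U P ->
  (forall s, least_cap s <= mean (transition P s (pi s)) least_cap + e) /\
  exists h, forall s,
    least_cap s - e + h s <= backup r h s (pi s) (transition P s (pi s)).
Proof.
move=> e0; apply: contrapT => nopi.
have /choice[bad Hbad] (pi : {ffun S -> A}) : exists P, U P /\
    ~ ((forall s, least_cap s <= mean (transition P s (pi s)) least_cap + e) /\
       exists h, forall s,
         least_cap s - e + h s <= backup r h s (pi s) (transition P s (pi s))).
  apply: contrapT => nP; apply: nopi; exists pi => P UP.
  by apply: contrapT => bad; apply: nP; exists P.
have /choice[good Hgood] s : exists P, U P /\ exists2 g, capped_by P g & g s < least_cap s + e.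
  by have [g [P UP Pg] ge] := least_cap_approx _ s e0; exists P; split => //; exists g.
pose fam (i : S + {ffun S -> A}) := match i with inl s => good s | inr pi => bad pi end.
have fam0 : (0 < #|{: S + {ffun S -> A}}|)%N.
  by have /card_gt0P[s _] := rmdp_states M; apply/card_gt0P; exists (inl s).
have Ufam i : U (fam i) by case: i => [s|pi]; [exact: (Hgood s).1|exact: (Hbad pi).1].
have [g [pi [g1 g2 g3]]] := finite_family_cap _ fam fam0 Ufam.
have cap_g s : least_cap s <= g s.
  by apply/ler_addgt0Pr => d d0; exact: (least_cap_le _ _ (g1 d d0)).
(* Against [good s], the gain of [pi] is at least [g s - d] and at most a cap within [e] of
   [least_cap s]. *)
have g_cap s : g s <= least_cap s + e.
  have [Us [g' Pg' /ltW ge]] := Hgood s; apply: le_trans ge.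
  apply/ler_addgt0Pr => d d0; rewrite -lerBlDr.
  apply: le_trans (gain_le_cap pi _ _ s Us Pg').
  apply: (gain_ge (sU _ Us) pi (fun s => g s - d)) => [t|].
    by rewrite meanD mean_cst; [rewrite lerD2r; exact: (g2 (inl s))|exact: sU].
  by have [h Hh] := g3 d d0; exists h; exact: (Hh (inl s)).
(* The family contains [bad pi], against which [pi] has just been certified. *)
have [Ub] := Hbad pi; apply; split=> [s|].
  apply: le_trans (cap_g s) _; apply: le_trans (g2 (inr pi) s) _.
  by apply: mean_le => //; exact: sU.
have [h Hh] := g3 e e0; exists h => s; apply: le_trans (Hh (inr pi) s).
by rewrite lerD2r lerD2r.
Qed.

(** There are finitely many policies, so one of them is near-optimal for arbitrarily small
    errors. *)
Lemma optimal_policy : exists pi : {ffun S -> A}, forall P, U P ->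
  (forall s, least_cap s <= mean (transition P s (pi s)) least_cap) /\
  forall e, 0 < e -> exists h, forall s,
    least_cap s - e + h s <= backup r h s (pi s) (transition P s (pi s)).
Proof.
have dr0 k : 0 < discount_rate k :> R by have /andP[] := @discount_rate_itv R k.
have /choice[f Hf] k := near_optimal_policy _ (dr0 k).
have [F [UF Foo]] := ultraFilterLemma (_ : ProperFilter \oo).
have [pi Fpi] := ultra_finite f.
have ex_rate (e : R) : 0 < e -> exists2 k, f k = pi & discount_rate k <= e.
  by move=> e0; have [k [fk dk]] := filter_ex (filterI Fpi (discount_rate_near F e Foo e0)); exists k.
exists pi => P UP; split=> [s|e e0].
  apply/ler_addgt0Pr => e e0; have [k fk ke] := ex_rate e e0.
  have [+ _] := Hf k P UP; rewrite fk => /(_ s) H; apply: le_trans H _.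
  by rewrite lerD2l.
have [k fk ke] := ex_rate e e0.
have [_ [h]] := Hf k P UP; rewrite fk => Hh.
by exists h => s; apply: le_trans (Hh s); rewrite lerD2r lerB.
Qed.

End RobustMDP.

(** * One potential for all kernels *)

Section UniformCertificate.
Context {R : realType} {S A : finType} {M : rmdp R S A}.
Context {Usa : S -> A -> set (S -> R)}.
Hypothesis rect : sa_rectangular (uncertainty M) Usa.
Local Notation U := (uncertainty M).

Let A0 : (0 < #|A|)%N := rmdp_actions M.
Let sU P : U P -> forall s a, simplex (transition P s a).
Proof. exact: uncertainty_prob. Qed.

(** Nature's problem against [pi] is a Bellman problem in which every action at [s] has the rewards
    and kernels of [pi s]. *)
Lemma discounted_kernel (r : S * A * S -> R) (pi : {ffun S -> A}) (l : R) : 0 < l < 1 ->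
  exists x : (S -> R) * (S * A * S -> R),
  [/\ U x.2,
      forall P s, U P -> x.1 s - l <=
        backup r (fun t => (1 - l) * x.1 t) s (pi s) (transition P s (pi s)) &
      forall s, backup r (fun t => (1 - l) * x.1 t) s (pi s) (transition x.2 s (pi s))
        <= x.1 s + l].
Proof.
move=> l01; have /andP[l0 _] := l01.
pose r' (x : S * A * S) := r (x.1.1, pi x.1.1, x.2).
pose V s (a : A) := Usa s (pi s).
have minV : minimized r' V.
  by move=> v s a; have [p Up [_ pmin]] := backup_min_attained r v s (pi s) rect; exists p.
have tB : topical (bellman r' V).
  by apply: bellman_topical => // s a; exact: rect.1.
have [C _ BC] := finite_norm_bound (bellman r' V (fun=> 0)).
have [v [_ vl]] := discounted_value tB C l l l01 l0 BC.
have [b [p [Vp Hb Hp]]] := bellman_optimizers r' V (fun t => (1 - l) * v t) A0 minV.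
have [P0 UP0] := uncertainty_neq0 M.
(* For [a] other than [pi s], [p s a] lies in [Usa s (pi s)] and perhaps not in [Usa s a], hence the
   filler [P0]. *)
pose q s a := if a == pi s then p s a else transition P0 s a.
exists (v, fun x => q x.1.1 x.1.2 x.2); split => [|P s UP|s] /=.
- apply: (rectangular_glue rect) => s a; rewrite /q.
  by case: eqVneq => [->|_]; [exact: Vp|exact: ((rectangularP rect _).1 UP0)].
- apply: le_trans (Hb s (transition P s (pi s)) ((rectangularP rect _).1 UP _ _)).
  by have := vl s; rewrite ler_norml => /andP[]; lra.
- have -> : transition (fun x => q x.1.1 x.1.2 x.2) s (pi s) = p s (pi s).
    by apply/funext => s'; rewrite /transition /q /= eqxx.
  apply: le_trans (Hp s (pi s)) _.
  by have := vl s; rewrite ler_norml => /andP[]; lra.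
Qed.

(* The discounted solutions [v_k] of nature's problem have optimal kernels
   accumulating at some [P0]; the certificate [h0] of [P0] is nearly valid for
   the nearby optimal kernels, which bounds the minimum of [v_k - h0] from below
   by [o(1 / l_k)]. *)
Lemma uniform_certificate (r : S * A * S -> R) (pi : {ffun S -> A}) :
  (forall P, U P -> forall e, 0 < e -> exists h, forall s,
    h s - e <= backup r h s (pi s) (transition P s (pi s))) ->
  forall e, 0 < e -> exists h, forall P s, U P ->
    h s - e <= backup r h s (pi s) (transition P s (pi s)).
Proof.
move=> cert e e0.
have /choice[x Hx] k := discounted_kernel r pi _ (@discount_rate_itv R k).
have [F [UF Foo]] := ultraFilterLemma (_ : ProperFilter \oo).
have [k|_ [P0 UP0 <-] cvgP] := ultra_compact_cvg (fun k => vec (x k).2) _ (@uncertainty_compact R S A M).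
  by exists (x k).2 => //; have [] := Hx k.
have cvgPx y : (x k).2 y @[k --> F] --> P0 y.
  have vecE P : vec P ord0 (enum_rank y) = P y :> R by rewrite mxE enum_rankK.
  have -> : (fun k => (x k).2 y) = (fun k => vec (x k).2 ord0 (enum_rank y)).
    by apply/funext => k; rewrite vecE.
  rewrite -(vecE P0).
  exact: continuous_cvg _ (@coord_continuous R _ _ ord0 (enum_rank y) (vec P0)) cvgP.
(* Four errors of size [d]: the certificate of [P0], the passage to a nearby kernel, [l (1 + 2 H)],
   and the precision [l]. *)
pose d := e / 4; have d0 : 0 < d by rewrite divr_gt0.
have [h0 Hh0] := cert P0 UP0 d d0.
have [H H0 hH] := finite_norm_bound h0.
have h0_near : \forall k \near F, forall s,
    h0 s - (d + d) <= backup r h0 s (pi s) (transition (x k).2 s (pi s)).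
  apply: filter_forall => s.
  have cb : backup r h0 s (pi s) (transition (x k).2 s (pi s)) @[k --> F] -->
      backup r h0 s (pi s) (transition P0 s (pi s)).
    by apply: cvg_mean => s'; [exact: cvgPx|exact: cvg_cst].
  apply: (cvgr_ge _ cb); apply: lt_le_trans (Hh0 s).
  by lra.
have H1 : 0 < 1 + H + H by lra.
have lH : 0 < d / (1 + H + H) by rewrite divr_gt0.
have [k [hk lk]] := filter_ex (filterI h0_near (discount_rate_near F _ Foo lH)).
have [_ vlow vup] := Hx k.
have /andP[l0 l1] := @discount_rate_itv R k.
set l := discount_rate k in lk l0 l1 vlow vup; set v := (x k).1 in vlow vup.
have {}lk : l * (1 + H + H) <= d by rewrite -ler_pdivlMr.
have /card_gt0P[s0 _] := rmdp_states M.
have [s1 _ s1min] := @Order.TotalTheory.arg_minP _ R S s0 xpredT (fun s => v s - h0 s) isT.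
set m := v s1 - h0 s1 in s1min.
(* At the minimizer [s1] of [v - h0], split [(1 - l) v] as [z + h0]: the terms [h0 s1] cancel, [z]
   is at least [(1 - l) m - l H], and only [l m] remains of [m]. *)
have m_low : - (d + d) - l * (1 + H) <= l * m.
  pose z s := (1 - l) * v s - h0 s.
  have zE : (fun s => (1 - l) * v s) = (fun s => z s + h0 s).
    by apply/funext => s; rewrite /z subrK.
  have z_low s : (1 - l) * m - l * H <= z s.
    have := hH s; rewrite ler_norml => /andP[_ hs].
    have : (1 - l) * m <= (1 - l) * (v s - h0 s) by apply: ler_wpM2l; [lra|exact: s1min].
    have : l * h0 s <= l * H by rewrite ler_pM2l.
    by rewrite /z; lra.
  have := vup s1; rewrite zE backupD.
  have sp : simplex (transition (x k).2 s1 (pi s1)) by apply: sU; have [] := Hx k.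
  have : (1 - l) * m - l * H <= mean (transition (x k).2 s1 (pi s1)) z.
    rewrite -[leLHS](mean_cst _ _ sp) -[leRHS]addr0.
    by apply: mean_le => // s; rewrite addr0.
  have := hk s1; rewrite /m; lra.
exists (fun s => (1 - l) * v s) => P s UP.
apply: le_trans (vlow P s UP).
have : l * m <= l * (v s - h0 s) by rewrite ler_pM2l //; exact: s1min.
have := hH s; rewrite ler_norml => /andP[hs _].
have : l * (- H) <= l * h0 s by rewrite ler_pM2l.
by rewrite /d in m_low lk; have := mulr_ge0 (ltW l0) H0; lra.
Qed.

End UniformCertificate.

(** * Growth of value iteration at the rate of the optimal gain *)

Section Growth.
Context {R : realType} {S A : finType} {M : rmdp R S A}.
Context {Usa : S -> A -> set (S -> R)}.
Hypothesis rect : sa_rectangular (uncertainty M) Usa.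
Local Notation r := (reward M).
Local Notation U := (uncertainty M).

Let A0 : (0 < #|A|)%N := rmdp_actions M.
Let sU P : U P -> forall s a, simplex (transition P s a).
Proof. exact: uncertainty_prob. Qed.
Let minU : minimized r Usa.
Proof.
by move=> v s a; have [p Up [_ pmin]] := backup_min_attained r v s a rect; exists p.
Qed.

(** A cap bounds the gain of any policy against the kernel of that cap; conversely the policy of
    [optimal_policy] gains at least [least_cap - e] against every kernel. *)
Lemma optimal_gainE s : optimal_gain M s = least_cap (M := M) s.
Proof.
have [pi Hpi] := optimal_policy rect.
have gain_inf_lb pi' : has_lbound [set gain r pi' P s | P in U].
  by have [c Hc] := @gain_lower_bound R S A M; exists c => _ [P UP <-]; exact: Hc.
have F0 : (0 < #|{ffun S -> A}|)%N by apply/card_gt0P; exists pi.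
rewrite /optimal_gain.
have [pi' -> pimax] := fmax_attained (fun pi : {ffun S -> A} => inf [set gain r pi P s | P in U]) F0.
apply/eqP; rewrite eq_le; apply/andP; split.
  apply: lb_le_inf.
    by have [g cg] := caps_neq0 rect; exists (g s), g.
  move=> _ [g [P UP Pg] <-].
  apply: le_trans (gain_le_cap pi' _ _ s UP Pg).
  by apply: ge_inf => //; exists P.
apply: le_trans (pimax pi); apply: lb_le_inf.
  by have [P UP] := uncertainty_neq0 M; exists (gain r pi P s), P.
move=> _ [P UP <-]; have [cap_sub cap_cert] := Hpi P UP.
apply/ler_addgt0Pr => e e0; rewrite -lerBlDr.
apply: (gain_ge (sU _ UP) pi (fun s => least_cap s - e)); last exact: cap_cert.
by move=> t; rewrite meanD mean_cst ?lerD2r //; exact: sU.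
Qed.

Lemma value_iterationE t : value_iteration r Usa t = iter t (bellman r Usa) (fun=> 0).
Proof. by elim: t => [//|t /= ->]. Qed.

Lemma value_iteration_ge (e : R) : 0 < e -> exists c, forall (t : nat) s,
  t%:R * (least_cap (M := M) s - e) - c <= value_iteration r Usa t s.
Proof.
move=> e0; have [pi Hpi] := optimal_policy rect.
(* Subtracting [least_cap] from the rewards brings the certificates to the form that
   [uniform_certificate] takes. *)
pose r0 (x : S * A * S) := r x - least_cap (M := M) x.1.1.
have r0E h s p : simplex p ->
    backup r0 h s (pi s) p = backup r h s (pi s) p - least_cap (M := M) s.
  move=> sp; rewrite -(mean_cst p (least_cap s) sp) !backup_mean -sumrB.
  by apply: eq_bigr => s' _; rewrite /r0 /=; ring.
have [|h Hh] := uniform_certificate rect r0 pi _ e e0.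
  move=> P UP d d0; have [h Hh] := (Hpi P UP).2 d d0; exists h => s.
  by rewrite r0E; [have := Hh s; lra|exact: sU].
have tB := bellman_reward_topical rect.
have [n s|c Hc] := iter_topical_ge tB (fun s => least_cap (M := M) s - e) h; last first.
  by exists c => t s; rewrite value_iterationE.
have [_ [p [Up _ Hp]]] := bellman_optimizers r Usa
  (fun t => n%:R * (least_cap (M := M) t - e) + h t) A0 minU.
apply: le_trans (Hp s (pi s)).
have UP := rectangular_glue rect p Up; set P := (fun x => _) in UP.
have sp := sU P UP s (pi s); rewrite -/(transition P s (pi s)) in sp *.
rewrite backupD meanZ meanD mean_cst // -natr1 mulrDl mul1r -addrA.
have cap_sub := (Hpi P UP).1 s; have := Hh P s UP; rewrite r0E // => Hs.
apply: lerD; first by rewrite ler_wpM2l // lerD2r.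
by rewrite /transition /= in Hs *; lra.
Qed.

(** For each state, nature repeats the kernel of a cap nearly least at that state; the finitely many
    constants obtained have a common bound. *)
Lemma value_iteration_le (e : R) : 0 < e -> exists c, forall (t : nat) s,
  value_iteration r Usa t s <= t%:R * (least_cap (M := M) s + e) + c.
Proof.
move=> e0.
have tB := bellman_reward_topical rect.
suff capB s : exists c, forall t : nat,
    value_iteration r Usa t s <= t%:R * (least_cap (M := M) s + e) + c.
  have /choice[c Hc] := capB; have [d _ cd] := finite_norm_bound c.
  exists d => t s; apply: le_trans (Hc s t) _; rewrite lerD2l.
  exact: le_trans (ler_norm _) (cd s).
have [g [P UP [gP [h hP]]] /ltW ge] := least_cap_approx rect _ s e0.
have [n s'|c Hc] := iter_topical_le tB g h; last first.
  exists c => t; rewrite value_iterationE; apply: le_trans (Hc t s) _.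
  by rewrite lerD2r ler_wpM2l.
have [pi [_ [_ Hpi _]]] := bellman_optimizers r Usa (fun t => n%:R * g t + h t) A0 minU.
apply: le_trans (Hpi _ _ ((rectangularP rect P).1 UP s' (pi s'))) _.
rewrite backupD meanZ -natr1 mulrDl mul1r -addrA.
by apply: lerD => //; rewrite ler_wpM2l.
Qed.

End Growth.

(** * Convergence of the averaged iterates, coordinate by coordinate *)

Theorem theorem5p2 (R : realType) (S A : finType) (M : rmdp R S A)
    (Usa : S -> A -> set (S -> R)) :
  sa_rectangular (uncertainty M) Usa ->
  definable [set vec P | P in uncertainty M] ->
  (fun t : nat => t%:R^-1 *: vec (value_iteration (reward M) Usa t)) @ \oo
    --> vec (optimal_gain M).
Proof.
move=> rect _; apply/cvg_ballP => e e0.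
have : \forall t \near \oo, forall j : 'I_#|S|, `|optimal_gain M (enum_val j) -
    t%:R^-1 * value_iteration (reward M) Usa t (enum_val j)| < e.
  apply: filter_forall => j.
  suff : t%:R^-1 * value_iteration (reward M) Usa t (enum_val j) @[t --> \oo]
      --> optimal_gain M (enum_val j) by move=> /cvgr_dist_lt; exact.
  rewrite (optimal_gainE rect); apply: average_cvg => d d0.
    by have [c Hc] := value_iteration_ge rect d d0; exists c => t; exact: Hc.
  by have [c Hc] := value_iteration_le rect d d0; exists c => t; exact: Hc.
by apply: filterS => t Ht; split => // i j; rewrite !mxE; exact: Ht.
Qed.
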